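(* Let $P=\{P_n(x)\}_{n=0}^{\infty}$ be an orthogonal polynomial sequence on the real line satisfying the three-term recurrence relation $$P_n(x)=(A_nx-B_n)P_{n-1}(x)-C_nP_{n-2}(x),\qquad n\ge 1,$$ with $P_{-1}(x)=0$, $P_0(x)=1$, where $A_n,B_n,C_n$ are real constants with $A_n>0$ and $C_n>0$ for each $n\ge1$. Let $M(x)=\frac{ax+b}{cx+d}$ with $a,b,c,d\in\mathbb{C}$, $ad-bc\ne0$, and set $R_n(x)=P_n(M(x))$ and $Q_n(x)=(cx+d)^nP_n(M(x))$ for $n\ge0$. Then $$R_n(x)=\left[A_n\left(\frac{ax+b}{cx+d}\right)-B_n\right]R_{n-1}(x)-C_nR_{n-2}(x),\qquad n\ge1,$$ with initial conditions $R_{-1}(x)=0$ and $R_0(x)=1$, and $$Q_n(x)=(\mathcal{A}_nx-\mathcal{B}_n)Q_{n-1}(x)-\mathcal{C}_n(cx+d)^2Q_{n-2}(x),\qquad n\ge1,$$ with initial conditions $Q_{-1}(x)=0$ and $Q_0(x)=1$, where $$\mathcal{A}_n=aA_n-cB_n,\qquad \mathcal{B}_n=dB_n-bA_n,\qquad \mathcal{C}_n=C_n.$$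
   Context: An orthogonal polynomial sequence on the real line is a sequence of real polynomials $P_n$ with $\deg P_n=n$ such that $\int_l^rP_mP_nw\,dx=K_m\delta_{m,n}$, $K_m>0$, for some interval $(l,r)\subseteq\mathbb{R}$ and some continuous non-negative weight function $w$ on it. $R_n$ is a rational function and $Q_n$ is a polynomial (the Möbius-transformed rational function and polynomial of $P_n$). *)

(* Defs.v *)
From HB Require Import structures.
From mathcomp Require Import all_boot all_order all_algebra.
From mathcomp Require Import all_classical all_reals all_analysis.
From mathcomp Require Import complex.
Set Implicit Arguments.
Unset Strict Implicit.
Unset Printing Implicit Defensive.
Import Order.TTheory GRing.Theory Num.Theory.
Import numFieldNormedType.Exports.
Local Open Scope classical_set_scope.
Local Open Scope ring_scope.

Notation "x %:F" := (@FracField.tofrac _ x) : ring_scope.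

(* The endpoints range over \bar R, so that half-lines and the whole line are
   allowed. *)
Definition open_interval (R : realType) (l r : \bar R) : set R :=
  [set x : R | (l < x%:E)%E /\ (x%:E < r)%E].

(* Integrability is part of the definition because \int is a total operator,
   which says nothing about a product that is not integrable. *)
Definition orthogonal_polynomial_sequence (R : realType)
    (P : nat -> {poly R}) : Prop :=
  (forall n, size (P n) = n.+1) /\
  exists (l r : \bar R) (w : R -> R) (K : nat -> R),
    [/\ (l < r)%E,
        {in open_interval l r, continuous w},
        forall x, open_interval l r x -> 0 <= w x,
        forall m, 0 < K m &
        forall m n,
          (@lebesgue_measure R).-integrable (open_interval l r)
            (fun x => ((P m).[x] * (P n).[x] * w x)%:E) /\
          (\int[@lebesgue_measure R]_(x in open_interval l r)
             ((P m).[x] * (P n).[x] * w x)%:E = (K m *+ (m == n))%:E)%E].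

(* Elements of {fraction {poly K}} are the rational functions in 'X. *)
Definition ratfun_const (K : fieldType) (z : K) : {fraction {poly K}} :=
  (z%:P)%:F.

Definition moebius (K : fieldType) (a b c d : K) : {fraction {poly K}} :=
  (a *: 'X + b%:P)%:F / (c *: 'X + d%:P)%:F.

Definition moebius_ratfun (R : realType) (a b c d : R[i]) (p : {poly R}) :
    {fraction {poly R[i]}} :=
  (map_poly (fun t : R => ratfun_const (real_complex R t)) p).[moebius a b c d].

(* The exponent is an integer so that the index -1 is covered as well. *)
Definition moebius_poly (R : realType) (a b c d : R[i]) (n : int)
    (p : {poly R}) : {fraction {poly R[i]}} :=
  ((c *: 'X + d%:P)%:F) ^ n * moebius_ratfun a b c d p.

(* Main.v *)
(* Evaluation at M is a ring morphism from real polynomials to complex rational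
   functions, so it carries the recurrence of P to R_n. Multiplying by the n-th
   power of cx + d gives the recurrence of Q_n, whose coefficients are
   polynomials; together with Q_(-1) = 0 and Q_0 = 1 it shows that each Q_n is
   a polynomial. *)
Require Import Defs.
From HB Require Import structures.
From mathcomp Require Import all_boot all_order all_algebra.
From mathcomp Require Import all_classical all_reals all_analysis.
From mathcomp Require Import complex ring.
Set Implicit Arguments.
Unset Strict Implicit.
Unset Printing Implicit Defensive.
Import Order.TTheory GRing.Theory Num.Theory.
Import numFieldNormedType.Exports.
Local Open Scope ring_scope.

(** If the denominator vanished, its coefficients of degree 0 and 1 would give [d = 0] and [c = 0],
    and the determinant would be zero. *)
Lemma moebius_den_neq0 (K : fieldType) (a b c d : K) :
  a * d - b * c != 0 -> (c *: 'X + d%:P)%:F != 0.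
Proof.
move=> abcd; rewrite tofrac_eq0; apply: contra abcd => /eqP cd0.
have d0 : d = 0 by have := congr1 (coefp 0) cd0; rewrite /= !coefE mulr0 add0r.
have c0 : c = 0 by have := congr1 (coefp 1) cd0; rewrite /= !coefE mulr1 addr0.
by rewrite c0 d0 !mulr0 subrr.
Qed.

(** This convertible form displays the coefficient map as a composite of ring morphisms, so that the
    [rmorph] lemmas apply. *)
Lemma moebius_ratfunE (R : realType) (a b c d : R[i]) (p : {poly R}) :
  moebius_ratfun a b c d p =
  horner_eval (moebius a b c d)
    (map_poly (@tofrac {poly R[i]} \o polyC \o real_complex R) p).
Proof. by []. Qed.

Lemma moebius_ratfun0 (R : realType) (a b c d : R[i]) :
  moebius_ratfun a b c d 0 = 0.
Proof. by rewrite moebius_ratfunE !rmorph0. Qed.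

Lemma moebius_ratfun1 (R : realType) (a b c d : R[i]) :
  moebius_ratfun a b c d 1 = 1.
Proof. by rewrite moebius_ratfunE !rmorph1. Qed.

Lemma map_poly_rec_horner (K : nzRingType) (L : comNzRingType)
    (f : {rmorphism K -> L}) (x y z : K) (p q : {poly K}) (u : L) :
  (map_poly f ((x *: 'X - y%:P) * p - z *: q)).[u] =
  (f x * u - f y) * (map_poly f p).[u] - f z * (map_poly f q).[u].
Proof.
rewrite rmorphB rmorphM rmorphB /= !map_polyZ map_polyX map_polyC.
by rewrite !(hornerE, hornerZ).
Qed.

Lemma moebius_ratfun_rec (R : realType) (a b c d : R[i]) (x y z : R)
    (p q : {poly R}) :
  moebius_ratfun a b c d ((x *: 'X - y%:P) * p - z *: q) =
  (ratfun_const (real_complex R x) * moebius a b c d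
     - ratfun_const (real_complex R y)) * moebius_ratfun a b c d p
  - ratfun_const (real_complex R z) * moebius_ratfun a b c d q.
Proof.
by rewrite !moebius_ratfunE /horner_eval map_poly_rec_horner.
Qed.

(** In the first term one factor [D] taken from [D ^ n] clears the denominator of [N / D]; in the
    second, two factors are split off and stay beside [z]. Since [n - 2] may be negative, adding
    exponents requires [D] to be invertible. *)
Lemma moebius_term_rec (F : fieldType) (D N x y z r s : F) (n : int) :
  D != 0 ->
  D ^ n * ((x * (N / D) - y) * r - z * s) =
  (x * N - y * D) * (D ^ (n - 1) * r) - z * D ^+ 2 * (D ^ (n - 2) * s).
Proof.
move=> D0.
(* Both higher powers are expressed through [D ^ (n - 2)], which then acts as an atom for
   [field]. *)
have -> : D ^ n = D ^ (n - 2) * D ^+ 2.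
  by rewrite -[D ^+ 2]/(D ^ 2) -expfzDr // subrK.
have -> : D ^ (n - 1) = D ^ (n - 2) * D.
  by rewrite -[X in _ * X]expr1z -expfzDr //; congr (D ^ _); ring.
by field.
Qed.

Lemma moebius_poly_rec (R : realType) (a b c d : R[i]) (x y z : R)
    (p q : {poly R}) (n : int) :
  a * d - b * c != 0 ->
  let toC := real_complex R in
  moebius_poly a b c d n ((x *: 'X - y%:P) * p - z *: q) =
  ((a * toC x - c * toC y) *: 'X - (d * toC y - b * toC x)%:P)%:F
    * moebius_poly a b c d (n - 1) p
  - (toC z *: (c *: 'X + d%:P) ^+ 2)%:F * moebius_poly a b c d (n - 2) q.
Proof.
move=> abcd toC; have D0 := moebius_den_neq0 abcd.
rewrite /moebius_poly moebius_ratfun_rec /moebius /ratfun_const -/toC.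
(* Collecting [x * N - y * D] by powers of ['X], with [N] and [D] the numerator and denominator of
   the Moebius map, produces the coefficients [calA] and [calB] of the theorem. *)
have -> : (a * toC x - c * toC y) *: 'X - (d * toC y - b * toC x)%:P =
    (toC x)%:P * (a *: 'X + b%:P) - (toC y)%:P * (c *: 'X + d%:P).
  by rewrite -!mul_polyC !(rmorphB, rmorphM) /=; ring.
by rewrite -[toC z *: _]mul_polyC !(tofracB, tofracM, tofracXn) moebius_term_rec.
Qed.

Theorem theorem4 (R : realType) (P : int -> {poly R}) (A B C : nat -> R)
    (a b c d : R[i])
    (P_ops : orthogonal_polynomial_sequence (fun n : nat => P n%:Z))
    (P_rec : forall n : nat, (1 <= n)%N ->
       P n%:Z = (A n *: 'X - (B n)%:P) * P (n%:Z - 1) - C n *: P (n%:Z - 2))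
    (P_m1 : P (-1) = 0) (P_0 : P 0 = 1)
    (A_gt0 : forall n : nat, (1 <= n)%N -> 0 < A n)
    (C_gt0 : forall n : nat, (1 <= n)%N -> 0 < C n)
    (abcd : a * d - b * c != 0) :
  let toC : R -> R[i] := real_complex R in
  let M : {fraction {poly R[i]}} := moebius a b c d in
  let Rr : int -> {fraction {poly R[i]}} :=
    fun n => moebius_ratfun a b c d (P n) in
  let Q : int -> {fraction {poly R[i]}} :=
    fun n => moebius_poly a b c d n (P n) in
  let calA : nat -> R[i] := fun n => a * toC (A n) - c * toC (B n) in
  let calB : nat -> R[i] := fun n => d * toC (B n) - b * toC (A n) in
  let calC : nat -> R[i] := fun n => toC (C n) in
  [/\ forall n : nat, (1 <= n)%N ->
        Rr n%:Z = (ratfun_const (toC (A n)) * M - ratfun_const (toC (B n)))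
                    * Rr (n%:Z - 1)
                  - ratfun_const (toC (C n)) * Rr (n%:Z - 2),
      Rr (-1) = 0 /\ Rr 0 = 1,
      forall n : nat, exists q : {poly R[i]}, Q n%:Z = q%:F,
      forall n : nat, (1 <= n)%N ->
        Q n%:Z = (calA n *: 'X - (calB n)%:P)%:F * Q (n%:Z - 1)
                 - (calC n *: (c *: 'X + d%:P) ^+ 2)%:F * Q (n%:Z - 2)
    & Q (-1) = 0 /\ Q 0 = 1].
Proof.
move=> toC M Rr Q calA calB calC.
have Rm1 : Rr (-1) = 0 by rewrite /Rr P_m1 moebius_ratfun0.
have R0 : Rr 0 = 1 by rewrite /Rr P_0 moebius_ratfun1.
have Qm1 : Q (-1) = 0 by rewrite /Q /moebius_poly -/(Rr (-1)) Rm1 mulr0.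
have Q0 : Q 0 = 1 by rewrite /Q /moebius_poly -/(Rr 0) R0 expr0z mulr1.
have Qrec (n : nat) : (1 <= n)%N ->
    Q n%:Z = (calA n *: 'X - (calB n)%:P)%:F * Q (n%:Z - 1)
             - (calC n *: (c *: 'X + d%:P) ^+ 2)%:F * Q (n%:Z - 2).
  by move=> n1; rewrite /Q P_rec // moebius_poly_rec.
(* The recurrence has order two, so the induction carries two consecutive values, starting from the
   indices 0 and -1. *)
have Qpoly (n : nat) : (exists q, Q n%:Z = q%:F) /\ (exists q, Q (n%:Z - 1) = q%:F).
  elim: n => [|n [[p Qn] [q Qn1]]].
    by split; [exists 1; rewrite Q0 tofrac1|exists 0; rewrite Qm1 tofrac0].
  have e1 : n.+1%:Z - 1 = n%:Z by rewrite intS; ring.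
  have e2 : n.+1%:Z - 2 = n%:Z - 1 by rewrite intS; ring.
  split; last by exists p; rewrite e1.
  (* Gathering the right-hand side under one [tofrac] exhibits the polynomial witness. *)
  by rewrite Qrec // e1 e2 Qn Qn1 -!tofracM -tofracB; eexists.
split=> // n; last exact: (Qpoly n).1.
by move=> n1; rewrite /Rr P_rec // moebius_ratfun_rec.
Qed.
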